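(* Let $T$ be a linear relation from a Hilbert space $\mathfrak H$ to a Hilbert space $\mathfrak K$, and let $P$ be the orthogonal projection from $\mathfrak K$ onto $\operatorname{mul}\overline T$. Then for all $\{\varphi,\varphi'\}\in T$: $$\|P\varphi'\|^2=\|\varphi'\|^2+\inf_{h\in\operatorname{dom}T}\left\{\|\varphi+h\|^2-\inf_{\{g,g'\}\in T}\left\{\|g'\|^2+\|g+h\|^2\right\}\right\},$$ and $$\|(I-P)\varphi'\|^2=\sup_{h\in\operatorname{dom}T}\ \inf_{\{g,g'\}\in T}\left\{\|g+h\|^2-\|\varphi+h\|^2+\|g'\|^2\right\}.$$
   Context: Hilbert spaces are complex. A linear relation $T$ from $\mathfrak H$ to $\mathfrak K$ is a (not necessarily closed) linear subspace of the Hilbert space $\mathfrak H\times\mathfrak K$, with elements written $\{f,f'\}$; $\overline T$ is its closure in $\mathfrak H\times\mathfrak K$. Notation: $\operatorname{dom}T=\{f\in\mathfrak H:\{f,f'\}\in T\text{ for some }f'\}$ and $\operatorname{mul}\overline T=\{f'\in\mathfrak K:\{0,f'\}\in\overline T\}$, a closed subspace of $\mathfrak K$. *)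

(* Defs.v *)
From HB Require Import structures.
From mathcomp Require Import all_boot all_order all_algebra.
From mathcomp Require Import all_classical all_reals all_analysis.
From mathcomp Require Import sesquilinear complex.

Set Implicit Arguments.
Unset Strict Implicit.
Unset Printing Implicit Defensive.

Import Order.TTheory GRing.Theory Num.Theory.
Import numFieldNormedType.Exports.

Local Open Scope classical_set_scope.
Local Open Scope ring_scope.

(* [inner] is linear in its first argument and conjugate-linear in the
   second. *)
HB.mixin Record NormedModule_hasInner (R : realType) (H : Type)
    of NormedModule (complex R) H := {
  inner : {dot H for (@Num.conj (complex R))} ;
  inner_normE : forall x : H, inner x x = `|x| ^+ 2
}.

#[short(type="hilbertType")]
HB.structure Definition Hilbert (R : realType) :=
  {H of NormedModule_hasInner R H & CompleteNormedModule (complex R) H}.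

(* The norm [`|x|] takes its values in the scalar field R[i], where it is real
   and nonnegative; [hnorm x] is the same number as an element of R. *)
Definition hnorm (R : realType) (H : hilbertType R) (x : H) : R :=
  complex.Re `|x|.

Section LinearRelations.
Variables (R : realType) (H K : hilbertType R).

Definition linear_relation (T : set (H * K)) : Prop :=
  submod_closed (mem T).

Definition rel_dom (T : set (H * K)) : set H := [set f | exists f', T (f, f')].

Definition rel_mul (T : set (H * K)) : set K := [set f' | T (0, f')].

End LinearRelations.

(* For a closed subspace M such a P exists and is unique. *)
Definition orthogonal_projection (R : realType) (K : hilbertType R)
    (M : set K) (P : K -> K) : Prop :=
  forall x, M (P x) /\ forall m, M m -> inner (x - P x) m = 0.

(* Main.v *)
(** Put F h (g, g') = |g + h|^2 - |phi + h|^2 + |g'|^2; both formulas say that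
sup_h inf_T F h = |(I - P) phi'|^2.  Since (phi, (I - P) phi') lies in the
closure of T, approximating it in T gives "<=" for each h.  For ">=" penalize:
let v_l be the infimum over T of |g'|^2 + l |g - phi|^2.  If this infimum is
attained at (g, g'), its Euler equation says that (g, g') also minimizes F h
for h = l (g - phi) - g, with value at least v_l; near-minimizers do the same
up to a small error, and they keep h in dom T.  As l grows, near-minimizers
form a Cauchy sequence by the parallelogram law, and their limit (phi, psi) in
the closure of T satisfies |psi|^2 <= sup v_l.  Finally phi' - psi lies in
mul of the closure of T, so |(I - P) phi'| <= |psi|. *)

Require Import Defs.
From mathcomp Require Import all_boot all_order all_algebra.
From mathcomp Require Import all_classical all_reals all_analysis.
From mathcomp Require Import complex.
From mathcomp Require Import ring lra.
From mathcomp Require sesquilinear.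

Set Implicit Arguments.
Unset Strict Implicit.
Unset Printing Implicit Defensive.

Import Order.TTheory GRing.Theory Num.Theory.
Import numFieldNormedType.Exports.

Local Open Scope classical_set_scope.
Local Open Scope ring_scope.

(** * Real-valued norm and real part of the inner product *)

Section InnerProduct.
Variables (R : realType) (H : hilbertType R).
Implicit Types (x y z : H) (a : R).

Lemma hnorm_ge0 x : 0 <= hnorm x.
Proof. by have := normr_ge0 x; rewrite lecE => /andP[]. Qed.

Lemma normr_hnorm x : `|x| = (hnorm x)%:C%C.
Proof. by rewrite RRe_real // ger0_real. Qed.

Lemma hnormD x y : hnorm (x + y) <= hnorm x + hnorm y.
Proof. by have := ler_normD x y; rewrite !normr_hnorm -rmorphD /= lecR. Qed.

Lemma hnormN x : hnorm (- x) = hnorm x.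
Proof. by rewrite /hnorm normrN. Qed.

Lemma hnormB x y : hnorm (x - y) = hnorm (y - x).
Proof. by rewrite /hnorm distrC. Qed.

(** Taking the real part gives a symmetric form, bilinear over [R], so squared norms expand into
    real polynomials that [lra] can handle. *)
Definition rinner x y : R := complex.Re (inner x y).

Lemma hnorm_sqr x : hnorm x ^+ 2 = rinner x x.
Proof. by rewrite /rinner inner_normE normr_hnorm -rmorphXn. Qed.

Lemma rinnerC x y : rinner x y = rinner y x.
Proof.
have ReJ (z : R[i]) : complex.Re (Num.conj z) = complex.Re z by case: z.
by rewrite /rinner sesquilinear.hermC mul1r ReJ.
Qed.

Lemma rinnerDl x y z : rinner (x + y) z = rinner x z + rinner y z.
Proof. by rewrite /rinner sesquilinear.linearDl raddfD. Qed.

Lemma rinnerNl x y : rinner (- x) y = - rinner x y.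
Proof. by rewrite /rinner sesquilinear.linearNl raddfN. Qed.

Lemma rinnerZl a x y : rinner (a%:C%C *: x) y = a * rinner x y.
Proof.
rewrite /rinner sesquilinear.linearZl_LR /=.
by case: (inner x y) => u v /=; rewrite mul0r subr0.
Qed.

Lemma rinnerDr x y z : rinner z (x + y) = rinner z x + rinner z y.
Proof. by rewrite !(rinnerC z) rinnerDl. Qed.

Lemma rinnerNr x y : rinner y (- x) = - rinner y x.
Proof. by rewrite !(rinnerC y) rinnerNl. Qed.

Lemma rinnerZr a x y : rinner y (a%:C%C *: x) = a * rinner y x.
Proof. by rewrite !(rinnerC y) rinnerZl. Qed.

Definition rinnerE := (rinnerDl, rinnerDr, rinnerNl, rinnerNr,
  rinnerZl, rinnerZr).

End InnerProduct.

(** * Penalized minimization over a linear relation *)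

Section Relation.
Variables (R : realType) (H K : hilbertType R) (T : set (H * K)).
Hypothesis hT : linear_relation T.

(** Balls have radii in [R[i]], but a positive element there has zero imaginary part, so real radii
    suffice. *)
Lemma closure_hnormP a b : closure T (a, b) <->
  forall e : R, 0 < e ->
  exists2 x, T x & hnorm (x.1 - a) < e /\ hnorm (x.2 - b) < e.
Proof.
split=> [clT e e0|approx B /nbhs_ballP[e /=]].
  have e0C : 0 < e%:C%C by rewrite ltcR.
  have /clT[x [Tx]] : nbhs (a, b) (ball (a, b) e%:C%C) by exact: nbhsx_ballx.
  rewrite /ball/= /prod_ball -!ball_normE /ball_/= !normr_hnorm !ltcR => xab.
  by exists x => //; rewrite (hnormB x.1) (hnormB x.2).
rewrite ltcE/= => /andP[/eqP eR e0] ballB.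
have [x Tx [xa xb]] := approx _ e0.
exists x; split=> //; apply: ballB.
rewrite /ball/= /prod_ball -!ball_normE /ball_/= !normr_hnorm !ltcE/=.
by rewrite eR eqxx (hnormB a) (hnormB b).
Qed.

Lemma linrel_comb c x y : T x -> T y -> T (c *: x + y).
Proof.
by case: hT => _ + Tx Ty => /(_ c x y); rewrite !inE; exact.
Qed.

Lemma linrelB x y : T x -> T y -> T (y - x).
Proof. by move=> Tx Ty; rewrite -scaleN1r addrC; exact: linrel_comb. Qed.

Lemma linrelN x : T x -> T (- x).
Proof.
move=> Tx; rewrite -[- x]add0r; apply: linrelB => //.
by rewrite -(subrr x); exact: linrelB.
Qed.

Lemma rel_dom_fst x : T x -> rel_dom T x.1.
Proof. by case: x => a b Tab; exists b. Qed.

Variable phi : H.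

Definition penalty (l : R) (x : H * K) : R :=
  hnorm x.2 ^+ 2 + l * hnorm (x.1 - phi) ^+ 2.

(** Approximate Euler equation: a step of length [l^-1] from [x0] towards [x] lowers the penalty by
    at most [d]; multiplying by [l] turns [d] into the error [l * d]. *)
Lemma penalty_dual (l d v : R) x0 : 1 <= l ->
    (forall x, T x -> v <= penalty l x) -> T x0 -> penalty l x0 <= v + d ->
    let h := l%:C%C *: (x0.1 - phi) - x0.1 in
  forall x, T x ->
  v - l * d <=
  hnorm (x.1 + h) ^+ 2 - hnorm (phi + h) ^+ 2 + hnorm x.2 ^+ 2.
Proof.
move=> l1 vP Tx0 x0d h x Tx.
have l0 : 0 < l by lra.
set D := x0.1 - phi in h *.
set k := x.1 - x0.1; set k' := x.2 - x0.2.
have -> : x.1 + h = k + l%:C%C *: D by rewrite /h /k addrCA addrC.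
have -> : phi + h = (l - 1)%:C%C *: D.
  rewrite rmorphB rmorph1 scalerBl scale1r /h /D opprB.
  by rewrite addrCA addrA.
have -> : x.2 = x0.2 + k' by rewrite /k' addrC subrK.
(* With step [l^-1] the second-order term, once multiplied by [l], is at most
   [|k|^2 + |k'|^2], the quadratic part of the expression to be bounded. *)
have /vP : T (l^-1%:C%C *: (x - x0) + x0).
  exact: linrel_comb (linrelB Tx0 Tx) Tx0.
move: (vP _ Tx0) x0d; rewrite /penalty/= -/D -addrA -/D -/k -/k'.
clearbody D k k'.
have := sqr_ge0 (hnorm D); have := sqr_ge0 (hnorm k').
rewrite !hnorm_sqr !rinnerE (rinnerC k D) (rinnerC k' x0.2).
move: (rinner k k) (rinner k' k') (rinner D D) (rinner D k) => kk kk' dd dk.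
move: (rinner x0.2 x0.2) (rinner x0.2 k') => gg gk.
set t := l^-1 => kk'0 dd0 vx0 x0v.
have t1 : t <= 1 by rewrite invf_le1.
move=> /(ler_wpM2l (ltW l0)).
set rhs := (X in _ <= X).
have -> : rhs = l * gg + 2 * gk + t * kk' + l * l * dd + 2 * l * dk + kk.
  rewrite /rhs /t; field.
  by rewrite gt_eqF.
have := ler_wpM2l (ltW l0) x0v.
have : t * kk' <= kk' by rewrite ler_piMl.
(* At [x0] the expression to be bounded equals [gg + (2 * l - 1) * dd], which is thus at least the
   penalty [gg + l * dd]. *)
have : dd <= l * dd by rewrite ler_peMl.
lra.
Qed.

Lemma penalty_le l m x : l <= m -> penalty l x <= penalty m x.
Proof. by move=> lm; rewrite lerD2l ler_wpM2r // sqr_ge0. Qed.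

Lemma penalty_ge0 l x : 0 <= l -> 0 <= penalty l x.
Proof. by move=> l0; rewrite addr_ge0 ?mulr_ge0 ?hnorm_ge0. Qed.

(* Parallelogram law for a squared seminorm centered at [(phi, 0)]. *)
Lemma penalty_parallelogram l x y : 0 <= l ->
  hnorm (x.2 - y.2) ^+ 2 <=
  2 * (penalty l x + penalty l y)
  - 4 * penalty l (2^-1%:C%C *: (x - y) + y).
Proof.
move=> l0; rewrite /penalty/= -[_ + y.1 - phi]addrA.
have -> : x.1 - y.1 = (x.1 - phi) - (y.1 - phi).
  by rewrite opprB addrA subrK.
move: (x.1 - phi) (y.1 - phi) (x.2) (y.2) => a b c d.
have := mulr_ge0 l0 (sqr_ge0 (hnorm (a - b))).
rewrite !hnorm_sqr !rinnerE (rinnerC b a) (rinnerC d c).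
lra.
Qed.

Definition infpenalty (l : R) : R := inf [set penalty l x | x in T].

Let T0 : T !=set0.
Proof. by exists 0; case: hT; rewrite inE. Qed.

Lemma has_inf_penalty l : 0 <= l -> has_inf [set penalty l x | x in T].
Proof.
move=> l0; split; first exact: image_nonempty.
by exists 0 => _ [x _ <-]; exact: penalty_ge0.
Qed.

Lemma infpenalty_lb l x : 0 <= l -> T x -> infpenalty l <= penalty l x.
Proof.
by move=> l0 Tx; apply: ge_inf; [case: (has_inf_penalty l0)|exists x].
Qed.

Lemma infpenalty_ge0 l : 0 <= l -> 0 <= infpenalty l.
Proof.
move=> l0; apply: lb_le_inf; first exact: image_nonempty.
by move=> _ [x _ <-]; exact: penalty_ge0.
Qed.

Lemma infpenalty_le l m : 0 <= l -> l <= m -> infpenalty l <= infpenalty m.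
Proof.
move=> l0 lm; apply: lb_le_inf; first exact: image_nonempty.
move=> _ [x Tx <-]; exact: le_trans (infpenalty_lb l0 Tx) (penalty_le _ lm).
Qed.

Lemma infpenalty_adherent l e : 0 <= l -> 0 < e ->
  exists2 x, T x & penalty l x < infpenalty l + e.
Proof.
move=> l0 e0; have [_ [x Tx <-] xe] := inf_adherent e0 (has_inf_penalty l0).
by exists x.
Qed.

(** The growing weight forces the first components of near-minimizers to [phi]; only the second
    components need a Cauchy argument. *)
Lemma penalty_limit (s : R) : (forall n, infpenalty n.+1%:R <= s) ->
  exists2 psi, closure T (phi, psi) & hnorm psi ^+ 2 <= s.
Proof.
move=> vs.
have s0 : 0 <= s by apply: le_trans (vs 0%N); exact: infpenalty_ge0.
have /choice[x xP] n : exists x, T x /\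
    penalty n.+1%:R x < infpenalty n.+1%:R + n.+1%:R^-1.
  have [x Tx xn] : exists2 x, T x &
      penalty n.+1%:R x < infpenalty n.+1%:R + n.+1%:R^-1.
    by apply: infpenalty_adherent; rewrite ?invr_gt0.
  by exists x.
have inv_small (e : R) : 0 < e -> \forall n \near \oo, n.+1%:R^-1 < e.
  by move=> e0; exact: (near_infty_natSinv_lt (PosNum e0)).
have vcvg : (infpenalty \o (fun n => n.+1%:R : R)) @ \oo -->
    sup (range (infpenalty \o (fun n => n.+1%:R))).
  apply: nondecreasing_cvgn => [m n mn|].
    by apply: infpenalty_le; rewrite ?ler_nat.
  by exists s => _ [n _ <-]; exact: vs.
set L := sup _ in vcvg.
have vL n : infpenalty n.+1%:R <= L.
  apply: ub_le_sup; last by exists n.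
  by exists s => _ [m _ <-]; exact: vs.
have ucauchy (e : R) : 0 < e -> exists N, forall m, (N <= m)%N ->
    hnorm ((x N).2 - (x m).2) < e.
  (* Comparing [x N], [x m] and their midpoint at the smaller weight [l = N.+1] bounds the squared
     distance by [2 * (L - infpenalty l) + 4 / l], hence by three quarters of [e ^+ 2]. *)
  move=> e0; have e80 : 0 < e ^+ 2 / 8 by rewrite divr_gt0 ?exprn_gt0.
  have vLe : \forall n \near \oo, `|L - infpenalty n.+1%:R| < e ^+ 2 / 8.
    by move/cvgrPdist_lt : vcvg; exact.
  have [N [vN aN]] : exists N, `|L - infpenalty N.+1%:R| < e ^+ 2 / 8 /\
      N.+1%:R^-1 < e ^+ 2 / 8.
    have [N [? ?]] := filter_ex (filterI vLe (inv_small _ e80)).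
    by exists N.
  exists N => m Nm; rewrite -(@ltr_pXn2r _ 2) ?nnegrE ?hnorm_ge0 ?(ltW e0)//.
  have [TxN xN] := xP N; have [Txm xm] := xP m.
  have N0 : 0 <= N.+1%:R :> R by [].
  have := penalty_parallelogram (x N) (x m) N0.
  have /(infpenalty_lb N0) := linrel_comb 2^-1%:C%C (linrelB Txm TxN) Txm.
  have : penalty N.+1%:R (x m) <= penalty m.+1%:R (x m).
    by apply: penalty_le; rewrite ler_nat.
  have : m.+1%:R^-1 <= N.+1%:R^-1 :> R by rewrite lef_pV2 ?posrE ?ler_nat.
  have := vL m; have := ler_norm (L - infpenalty N.+1%:R).
  move: vN aN xN xm N0; move: (N.+1%:R) (m.+1%:R) => l k.
  lra.
have [psi /cvgrPdist_lt xpsi] : exists psi : K, (x n).2 @[n --> \oo] --> psi.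
  apply/cvg_ex; apply: (@cauchy_cvg K); apply: cauchy_exP => e.
  rewrite ltcE/= => /andP[/eqP eR /ucauchy[N xN]].
  exists (x N).2; exists N => // m /= Nm.
  by rewrite -ball_normE /ball_/= normr_hnorm ltcE/= eR eqxx xN.
have {}xpsi (e : R) : 0 < e -> \forall n \near \oo, hnorm ((x n).2 - psi) < e.
  move=> e0; have e0C : 0 < e%:C%C by rewrite ltcR.
  apply: filterS (xpsi _ e0C) => n.
  by rewrite normr_hnorm ltcR hnormB.
exists psi.
  apply/closure_hnormP => e e0.
  (* This threshold makes [n.+1 * e ^+ 2] exceed [s + 1], which in turn exceeds the penalty of
     [x n]. *)
  have es0 : 0 < e ^+ 2 / (s + 1) by rewrite divr_gt0 ?exprn_gt0//; lra.
  have [n [nes ne]] := filter_ex (filterI (inv_small _ es0) (xpsi _ e0)).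
  have [Txn xn] := xP n; exists (x n) => //; split => //.
  rewrite -(@ltr_pXn2r _ 2) ?nnegrE ?hnorm_ge0 ?(ltW e0)//.
  have n0 : 0 < n.+1%:R :> R by [].
  rewrite -(ltr_pM2l n0).
  have : n.+1%:R^-1 <= 1 :> R by rewrite invf_le1 // ler1n.
  move: nes; rewrite ltr_pdivlMr ?ltr_wpDl// mulrC ltr_pdivrMr//.
  have := vs n; have := sqr_ge0 (hnorm (x n).2); move: xn; rewrite /penalty.
  move: (n.+1%:R) => l.
  lra.
apply/ler_addgt0Pr => e e0.
(* For the norm [a] of [(x n).2], the bounds [a ^+ 2 < s + d] and [a <= s + 2] give
   [(a + d) ^+ 2 <= s + d * (2 * s + 6)]. *)
pose d := Num.min 1 (e / (2 * s + 6)).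
have d0 : 0 < d by rewrite lt_min ltr01 divr_gt0//; lra.
have d1 : d <= 1 by rewrite ge_min lexx.
have de : d * (2 * s + 6) <= e.
  by rewrite -ler_pdivlMr ?ge_min ?lexx ?orbT//; lra.
have [n [nd xnd]] := filter_ex (filterI (inv_small _ d0) (xpsi _ d0)).
have [Txn xn] := xP n.
have := hnormD (x n).2 (psi - (x n).2); rewrite addrC subrK hnormB.
have := mulr_ge0 (ler0n R n.+1) (sqr_ge0 (hnorm ((x n).1 - phi))).
have := vs n; move: xn xnd; rewrite /penalty.
have := hnorm_ge0 psi; have := hnorm_ge0 (x n).2.
move: nd; move: (n.+1%:R) => l; move: (hnorm (_ - psi)) => c.
move: (hnorm (x n).2) (hnorm psi) (_ * _) => a b p.
move=> ld a0 b0 pa cd vs' p0 bac.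
have a2 : a ^+ 2 < s + d by lra.
have as2 : a <= s + 2 by nra.
have : b ^+ 2 <= (a + d) ^+ 2 by rewrite lerXn2r ?nnegrE//; lra.
have : a * d <= (s + 2) * d by rewrite ler_wpM2r // ltW.
have : d ^+ 2 <= d by rewrite expr2 ler_piMl // ltW.
rewrite sqrrD; lra.
Qed.

End Relation.

(** * Upper and lower bounds through the projection *)

Section Projection.
Variables (R : realType) (H K : hilbertType R) (T : set (H * K)).
Hypothesis hT : linear_relation T.
Variable P : K -> K.
Hypothesis hP : orthogonal_projection (rel_mul (closure T)) P.
Variables (phi : H) (phi' : K).
Hypothesis hphi : T (phi, phi').

(** Pythagoras: [psi] differs from [phi' - P phi'] by a vector orthogonal to the latter. *)
Lemma projection_min psi : closure T (phi, psi) ->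
  hnorm (phi' - P phi') ^+ 2 <= hnorm psi ^+ 2.
Proof.
move=> /closure_hnormP clpsi; have [Mp ortho] := hP phi'.
have /ortho op : rel_mul (closure T) (phi' - psi).
  apply/closure_hnormP => e /clpsi[x Tx [x1 x2]].
  exists ((phi, phi') - x); first exact: linrelB.
  split => /=; first by rewrite subr0 hnormB.
  by rewrite opprB addrC addrA subrK hnormB.
have {}op : rinner (phi' - P phi') (phi' - psi) = 0 by rewrite /rinner op.
have {ortho}oP : rinner (phi' - P phi') (P phi') = 0.
  by rewrite /rinner ortho.
have -> : psi = (phi' - P phi') + (P phi' - (phi' - psi)).
  by rewrite addrA subrK opprB addrC subrK.
move: (phi' - psi) (P phi') (phi' - P phi') op oP => m p q qm qp.
rewrite [leRHS]hnorm_sqr rinnerDl !(rinnerC _ (q + _)) !(rinnerDl q).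
rewrite -hnorm_sqr (rinnerC (p - m)) rinnerDr rinnerNr qm qp -hnorm_sqr.
by rewrite subrr !addr0 add0r lerDl sqr_ge0.
Qed.

Lemma dual_le h e : 0 < e -> exists2 x, T x &
  hnorm (x.1 + h) ^+ 2 - hnorm (phi + h) ^+ 2 + hnorm x.2 ^+ 2
  <= hnorm (phi' - P phi') ^+ 2 + e.
Proof.
move=> e0; have [/closure_hnormP Mp _] := hP phi'.
have := hnorm_ge0 (phi + h); have := hnorm_ge0 (phi' - P phi').
set a := hnorm (phi + h); set b := hnorm (phi' - P phi') => b0 a0.
(* Since [d <= 1], [(a + d) ^+ 2 - a ^+ 2 + (b + d) ^+ 2] is at most
   [b ^+ 2 + d * (2 * a + 2 * b + 2)]. *)
pose d := Num.min 1 (e / (2 * a + 2 * b + 2)).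
have d0 : 0 < d by rewrite lt_min ltr01 divr_gt0//; lra.
have d1 : d <= 1 by rewrite ge_min lexx.
have de : d * (2 * a + 2 * b + 2) <= e.
  by rewrite -ler_pdivlMr ?ge_min ?lexx ?orbT//; lra.
(* Here [x] approximates [(0, P phi')], so subtracting it from [(phi, phi')] approximates
   [(phi, phi' - P phi')] within [T]. *)
have [x Tx []] := Mp _ d0; rewrite subr0 => x1 x2.
exists ((phi, phi') - x); first exact: linrelB.
have c1 : hnorm (phi - x.1 + h) <= a + d.
  rewrite addrAC; apply: le_trans (hnormD _ _) _.
  by rewrite hnormN lerD // ltW.
have c2 : hnorm (phi' - x.2) <= b + d.
  have -> : phi' - x.2 = (phi' - P phi') + (P phi' - x.2).
    by rewrite addrA subrK.
  by apply: le_trans (hnormD _ _) _; rewrite (hnormB (P phi')) lerD // ltW.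
have : hnorm (phi - x.1 + h) ^+ 2 <= (a + d) ^+ 2.
  by rewrite lerXn2r ?nnegrE ?hnorm_ge0 ?addr_ge0 // ltW.
have : hnorm (phi' - x.2) ^+ 2 <= (b + d) ^+ 2.
  by rewrite lerXn2r ?nnegrE ?hnorm_ge0 ?addr_ge0 // ltW.
have : d ^+ 2 <= d by rewrite expr2 ler_piMl // ltW.
rewrite !sqrrD /=; lra.
Qed.

Lemma dual_ge e : 0 < e -> exists2 h, rel_dom T h & forall x, T x ->
  hnorm (phi' - P phi') ^+ 2 - e <=
  hnorm (x.1 + h) ^+ 2 - hnorm (phi + h) ^+ 2 + hnorm x.2 ^+ 2.
Proof.
move=> e0; set Q := hnorm (phi' - P phi') ^+ 2.
have [n Qn] : exists n, Q - e < infpenalty T phi n.+1%:R.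
  (* Otherwise [penalty_limit] would yield a [psi] with squared norm at most [Q - e], against
     [projection_min]. *)
  apply: contrapT => /forallNP Qv.
  have [n|psi /projection_min Qpsi psi_le] :=
      @penalty_limit _ _ _ _ hT phi (Q - e).
    by rewrite leNgt; apply/negP.
  by have := le_trans Qpsi psi_le; rewrite -/Q; lra.
have n0 : 0 < n.+1%:R :> R by [].
(* Tolerance for which the bound [v - l * d] of [penalty_dual] is exactly [Q - e]. *)
have d0 : 0 < (infpenalty T phi n.+1%:R - (Q - e)) / n.+1%:R.
  by rewrite divr_gt0 ?subr_gt0.
have [x Tx /ltW xd] := infpenalty_adherent hT phi (ltW n0) d0.
exists (n.+1%:R%:C%C *: (x.1 - phi) - x.1).
  exact: rel_dom_fst (linrel_comb hT _ (linrelB hT hphi Tx) (linrelN hT Tx)).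
move=> y Ty.
have n1 : 1 <= n.+1%:R :> R by rewrite ler1n.
have := @penalty_dual _ _ _ _ hT phi _ _ _ _ n1
  (fun z => infpenalty_lb hT phi (ltW n0)) Tx xd _ Ty.
by rewrite mulrCA mulfV ?gt_eqF// mulr1 opprB addrCA subrr addr0.
Qed.

End Projection.

(** * Infima and suprema in the extended reals *)

Section ExtendedReals.
Variable R : realType.

Lemma ereal_inf_shift (B : Type) (Y : set B) (c : R) (f : B -> R) :
  ereal_inf [set (c + f y)%:E | y in Y] =
  (c%:E + ereal_inf [set (f y)%:E | y in Y])%E.
Proof.
have shift_ge (k : R) (g : B -> R) :
    (k%:E + ereal_inf [set (g y)%:E | y in Y] <=
     ereal_inf [set (k + g y)%:E | y in Y])%E.
  apply: le_ereal_inf_tmp => _ [y Yy <-].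
  by rewrite EFinD leeD2l// ereal_inf_lbound//; exists y.
apply/le_anti/andP; split; last exact: shift_ge.
(* The reverse inequality is the same bound for the shift [- c] applied to [c + f]. *)
rewrite addeC -leeBlDr// addeC -EFinN.
apply: le_trans (shift_ge _ _) _.
by under eq_imagel => y _ do rewrite addKr.
Qed.

(** Allows real estimates up to [e], without first showing that the inner infima are finite. *)
Lemma ereal_sup_inf_fin (A B : Type) (X : set A) (Y : set B) (f : A -> B -> R)
    (q : R) :
    (forall a e, X a -> 0 < e -> exists2 b, Y b & f a b <= q + e) ->
    (forall e, 0 < e -> exists2 a, X a & forall b, Y b -> q - e <= f a b) ->
  ereal_sup [set ereal_inf [set (f a b)%:E | b in Y] | a in X] = q%:E.
Proof.
move=> f_le f_ge; apply/le_anti/andP; split.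
  apply: ge_ereal_sup => _ [a Xa <-]; apply/lee_addgt0Pr => e e0.
  have [b Yb fab] := f_le a e Xa e0; apply: ge_ereal_inf.
  by exists (f a b)%:E; [exists b|rewrite -EFinD lee_fin].
apply/lee_subgt0Pr => e e0; have [a Xa fa] := f_ge e e0.
apply: le_ereal_sup_tmp; eexists; first by exists a.
by apply: le_ereal_inf_tmp => _ [b Yb <-]; rewrite -EFinB lee_fin fa.
Qed.

End ExtendedReals.

Theorem lemma5p3 (R : realType) (H K : hilbertType R) (T : set (H * K))
    (hT : linear_relation T) (P : K -> K)
    (hP : orthogonal_projection (rel_mul (closure T)) P)
    (phi : H) (phi' : K) (hphi : T (phi, phi')) :
  ((hnorm (P phi') ^+ 2)%:E =
     (hnorm phi' ^+ 2)%:E +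
     ereal_inf [set (hnorm (phi + h) ^+ 2)%:E -
                    ereal_inf [set (hnorm g.2 ^+ 2 + hnorm (g.1 + h) ^+ 2)%:E
                              | g in T]
               | h in rel_dom T])%E /\
  ((hnorm (phi' - P phi') ^+ 2)%:E =
     ereal_sup [set ereal_inf [set (hnorm (g.1 + h) ^+ 2 - hnorm (phi + h) ^+ 2
                                    + hnorm g.2 ^+ 2)%:E
                              | g in T]
               | h in rel_dom T])%E.
Proof.
set F := fun (h : H) (g : H * K) =>
  hnorm (g.1 + h) ^+ 2 - hnorm (phi + h) ^+ 2 + hnorm g.2 ^+ 2.
have supE : ereal_sup [set ereal_inf [set (F h g)%:E | g in T]
    | h in rel_dom T] = (hnorm (phi' - P phi') ^+ 2)%:E.
  apply: ereal_sup_inf_fin => [h e _|e] e0; first exact: dual_le.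
  exact: dual_ge.
split; last exact/esym.
(* Pulling the constant out of the inner infimum turns each outer term into minus the infimum of
   [F h], so the first formula follows from [supE]. *)
have -> : [set ((hnorm (phi + h) ^+ 2)%:E -
      ereal_inf [set (hnorm g.2 ^+ 2 + hnorm (g.1 + h) ^+ 2)%:E | g in T])%E
    | h in rel_dom T] =
    [set (- x)%E | x in [set ereal_inf [set (F h g)%:E | g in T]
    | h in rel_dom T]].
  rewrite image_comp; apply: eq_imagel => h _ /=.
  under eq_imagel => g _.
    rewrite (_ : _ + _ = hnorm (phi + h) ^+ 2 + F h g); last by rewrite /F; ring.
    over.
  rewrite ereal_inf_shift [in LHS](addeC _ (ereal_inf _)) fin_num_oppeD//.
  by rewrite addeCA subee// adde0.
rewrite ereal_infN supE -EFinB; congr _%:E.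
(* What remains is Pythagoras for [phi'] split into [P phi'] and [phi' - P phi']. *)
have [/= _ ortho] := hP phi'.
have oP : rinner (phi' - P phi') (P phi') = 0.
  by rewrite /rinner ortho//; case: (hP phi').
have -> : hnorm phi' ^+ 2 = hnorm ((phi' - P phi') + P phi') ^+ 2.
  by rewrite subrK.
move: oP; move: (P phi') (phi' - P phi') => p q qp.
rewrite !hnorm_sqr !rinnerE (rinnerC p) qp; ring.
Qed.
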